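(* If $0<\hat R\leq+\infty$ is the radius of convergence of $f(z)=\sum_{k=0}^{\infty}a_kz^k$, with $f\not\equiv 0$, then for each finite and positive $0<R\leq\hat R$, $f$ satisfies the $(N,R,S(k))$-Taylor domination property with $N$ being the index of its first nonzero Taylor coefficient, and $S(k)=R^k|a_k|\,(|a_N|R^N)^{-1}$ for $k>N$. Conversely, let $f$ possess $(N,R,S(k))$-Taylor domination. Then the series $\sum_{k=0}^{\infty}a_kz^k$ converges in a disk of radius $R^*$ satisfying $R^*\geq R$. For each $R'<R$ the function $f$ possesses $(N,R',C)$-Taylor domination, with the constant $C$ depending on $R'/R$ and on the sequence $S(k)$.
   Context: Taylor domination: let $f(z)=\sum_{k=0}^{\infty}a_kz^k$ be an analytic function whose Taylor series has radius of convergence $\hat R$, $0<\hat R\leq+\infty$. Let a positive finite $R\leq\hat R$, a natural number $N$ (the value $0$ being allowed), and a positive sequence $S(k)$ of subexponential growth (i.e. $\limsup_{k\to\infty}S(k)^{1/k}\leq 1$) be fixed. The function $f$ is said to possess an $(N,R,S(k))$-Taylor domination property if for each $k\geq N+1$ $$|a_k|R^k\leq S(k)\max_{i=0,\dots,N}|a_i|R^i .$$ When $S(k)\equiv C$ is a constant, this is called $(N,R,C)$-Taylor domination.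
   Formalization: The sequence S(k) is only required to be nonnegative for k > N, since the prescribed S(k) vanishes where a_k = 0 (e.g. f = 1); the constant C may also depend on N, as no C uniform in N exists in general. *)

(* Defs.v *)
From Stdlib Require Import Reals.
From Coquelicot Require Import Coquelicot.
Open Scope R_scope.

(** The power series [sum_k a_k z^k] has radius of convergence [r]; this forces
    [0 <= r], since every power series converges at [0]. *)
Definition is_radius_of_convergence (a : nat -> C) (r : Rbar) : Prop :=
  (forall z : C, Rbar_lt (Cmod z) r -> @ex_pseries C_AbsRing C_NormedModule a z) /\
  (forall z : C, Rbar_lt r (Cmod z) -> ~ @ex_pseries C_AbsRing C_NormedModule a z).

(** [f] is the sum of [sum_k a_k z^k] on its whole disk of convergence, of radius [r]. *)
Definition has_Taylor_series (f : C -> C) (a : nat -> C) (r : Rbar) : Prop :=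
  is_radius_of_convergence a r /\
  (forall z : C, Rbar_lt (Cmod z) r ->
     @is_pseries C_AbsRing C_NormedModule a z (f z)).

Definition first_nonzero (a : nat -> C) (N : nat) : Prop :=
  a N <> RtoC 0 /\ (forall k : nat, (k < N)%nat -> a k = RtoC 0).

(** [k]-th root of a nonnegative real. [Rpower] alone would not do, because
    [Rpower 0 y = 1]. The values for [k = 0] or [x < 0] are irrelevant. *)
Definition kth_root (k : nat) (x : R) : R :=
  if Rlt_dec 0 x then Rpower x (/ INR k) else 0.

Definition subexponential (s : nat -> R) : Prop :=
  Rbar_le (LimSup_seq (fun k => kth_root k (s k))) 1.

(** [max_upto u n] is the maximum of [u 0], ..., [u n]. *)
Fixpoint max_upto (u : nat -> R) (n : nat) : R :=
  match n with
  | O => u O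
  | S m => Rmax (max_upto u m) (u (S m))
  end.

(** [(N, r, s)]-Taylor domination for the coefficient sequence [a].
    - "Positive" is read as [0 <= s k]: the sequence
      [r^k |a_k| / (|a_N| r^N)] vanishes wherever [a_k] does.
    - Only the values [s k] with [k > N] matter.
    - That [r] does not exceed the radius of convergence is not part of the
      definition, so that it can be a genuine consequence of domination. *)
Definition Taylor_domination (a : nat -> C) (N : nat) (r : R) (s : nat -> R) : Prop :=
  0 < r /\
  (forall k : nat, (N + 1 <= k)%nat -> 0 <= s k) /\
  subexponential s /\
  (forall k : nat, (N + 1 <= k)%nat ->
     Cmod (a k) * r ^ k <= s k * max_upto (fun i => Cmod (a i) * r ^ i) N).

(* Main.v *)
Require Import Defs.
From Stdlib Require Import Reals.
From Coquelicot Require Import Coquelicot.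
From Stdlib Require Import Lra Lia Classical Wf_nat.
Open Scope R_scope.

(** The theorem rests on two reformulations that remove roots and convergence.

    First, [s] is of subexponential growth exactly when, for every [x > 1],
    [s k <= x ^ k] for all large [k] ([subexponential_iff_le_pow]).

    Second, by Abel's lemma, the series converges in the open disk of radius
    [r] exactly when [|a_k| rho ^ k] is bounded in [k] for every [rho < r]: a
    convergent series has bounded terms ([ex_pseries_bounded_terms]), and
    bounded terms at [rho] give geometric convergence inside [rho].  Hence the
    complex series has the same radius as the real series of moduli
    ([CV_radius_Cmod_is_radius]).

    Existence of domination.  The inequality itself holds by the choice of [s],
    so the content is that [s k = |a_k| r ^ k / (|a_N| r ^ N)] grows
    subexponentially.  Given [x > 1], pick [rho < r] with [r / rho < x].  Since
    [rho < Rhat], [|a_k| rho ^ k] is bounded, so [s k] is at most a constant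
    times [(r / rho) ^ k], and that constant is absorbed by
    [(x rho / r) ^ k].

    Converse.  Put [q = r' / r < 1].  For [k > N], passing from [r] to [r']
    multiplies the left side of the inequality by [q ^ k] and the maximum over
    [i <= N] by at least [q ^ N]; so domination persists at [r'] with
    [s k * q ^ (k - N)] in place of [s k].  That sequence is bounded because
    [s k <= (1 / q) ^ k] eventually, and its supremum is the required constant.
    In particular [|a_k| r' ^ k] is bounded for every [r' < r], which places the
    radius of convergence at [r] or beyond. *)

(** * Growth of real sequences *)

Lemma bounded_of_eventually_le (u : nat -> R) (M : R) :
  eventually (fun k => u k <= M) -> exists B : R, 0 < B /\ forall k, u k <= B.
Proof.
  intros [n Hn]; revert M Hn.
  induction n as [|n IH]; intros M Hn.
  - exists (Rmax M 1); split.
    + generalize (Rmax_r M 1); lra.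
    + intros k; apply Rle_trans with M; [apply Hn; lia | apply Rmax_l].
  - apply (IH (Rmax M (u n))); intros k Hk.
    destruct (Nat.eq_dec k n) as [->|Hkn]; [apply Rmax_r|].
    apply Rle_trans with M; [apply Hn; lia | apply Rmax_l].
Qed.

Lemma eventually_le_pow (B x : R) : 1 < x -> eventually (fun k => B <= x ^ k).
Proof.
  intros Hx.
  generalize (proj1 (is_lim_seq_p_infty_Reals _) (is_lim_seq_geom_p x Hx) B).
  intros [n Hn]; exists n; intros k Hk; left; apply Hn; exact Hk.
Qed.

Lemma kth_root_le_iff (k : nat) (x y : R) :
  (0 < k)%nat -> 0 < x -> kth_root k y <= x <-> y <= x ^ k.
Proof.
  intros Hk Hx.
  assert (HK : 0 < INR k) by (apply lt_0_INR; exact Hk).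
  unfold kth_root; destruct (Rlt_dec 0 y) as [Hy|Hy].
  - assert (E : Rpower y (/ INR k) ^ k = y).
    { rewrite <- Rpower_pow by apply exp_pos.
      rewrite Rpower_mult, Rinv_l by lra; apply Rpower_1, Hy. }
    assert (E' : Rpower (x ^ k) (/ INR k) = x).
    { rewrite <- Rpower_pow by exact Hx.
      rewrite Rpower_mult, Rinv_r by lra; apply Rpower_1, Hx. }
    split; intros H.
    + rewrite <- E; apply pow_incr; split; [left; apply exp_pos | exact H].
    + rewrite <- E'; apply Rle_Rpower_l; [|lra].
      left; apply Rinv_0_lt_compat, HK.
  - generalize (pow_lt x k Hx); lra.
Qed.

(** Taking [k]-th powers turns a limsup of roots into a comparison with
    geometric sequences.  Where [s k <= 0], [kth_root] vanishes and both
    inequalities hold at [k]. *)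
Lemma subexponential_iff_le_pow (s : nat -> R) :
  subexponential s <-> forall x, 1 < x -> eventually (fun k => s k <= x ^ k).
Proof.
  unfold subexponential; split; intros H.
  - intros x Hx.
    assert (Hroot : eventually (fun k => kth_root k (s k) <= x)).
    { destruct (ex_LimSup_seq (fun k => kth_root k (s k))) as [l Hl].
      rewrite (is_LimSup_seq_unique _ _ Hl) in H.
      destruct l as [l| |]; simpl in H; [|contradiction|].
      - assert (He : 0 < x - l) by lra.
        destruct (proj2 (Hl (mkposreal _ He))) as [n Hn]; exists n.
        intros k Hk; specialize (Hn k Hk); simpl in Hn; lra.
      - destruct (Hl x) as [n Hn]; exists n.
        intros k Hk; left; apply Hn, Hk. }
    destruct Hroot as [n Hn]; exists (S n); intros k Hk.
    apply kth_root_le_iff; [lia | lra | apply Hn; lia].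
  - assert (Hle : forall x, 1 < x ->
              Rbar_le (LimSup_seq (fun k => kth_root k (s k))) x).
    { intros x Hx; rewrite <- (LimSup_seq_const x); apply LimSup_le.
      destruct (H x Hx) as [n Hn]; exists (S n); intros k Hk.
      apply kth_root_le_iff; [lia | lra | apply Hn; lia]. }
    destruct (LimSup_seq _) as [l| |]; simpl.
    + apply le_epsilon; intros eps Heps; apply (Hle (1 + eps)); lra.
    + apply (Hle 2); lra.
    + exact I.
Qed.

Lemma subexponential_const (c : R) : subexponential (fun _ => c).
Proof.
  apply subexponential_iff_le_pow; intros x Hx; apply eventually_le_pow, Hx.
Qed.

Lemma le_max_upto (u : nat -> R) (n i : nat) : (i <= n)%nat -> u i <= max_upto u n.
Proof.
  induction n as [|n IH]; intros Hi; simpl.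
  - replace i with O by lia; apply Rle_refl.
  - destruct (Nat.eq_dec i (S n)) as [->|Hne]; [apply Rmax_r|].
    apply Rle_trans with (max_upto u n); [apply IH; lia | apply Rmax_l].
Qed.

Lemma max_upto_le (u : nat -> R) (n : nat) (M : R) :
  (forall i, (i <= n)%nat -> u i <= M) -> max_upto u n <= M.
Proof.
  induction n as [|n IH]; intros H; simpl; [apply H; lia|].
  apply Rmax_lub; [apply IH; intros i Hi; apply H; lia | apply H; lia].
Qed.

(** * Complex power series and the moduli of their coefficients *)

Lemma Cmod_pow_n (z : C) (k : nat) : Cmod (@pow_n C_AbsRing z k) = Cmod z ^ k.
Proof.
  induction k as [|k IH]; [apply Cmod_1|].
  change (Cmod (Cmult z (@pow_n C_AbsRing z k)) = Cmod z * Cmod z ^ k).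
  rewrite Cmod_mult, IH; reflexivity.
Qed.

Lemma norm_pseries_term (a : nat -> C) (z : C) (k : nat) :
  @norm C_AbsRing C_NormedModule
    (@scal C_AbsRing C_NormedModule (@pow_n C_AbsRing z k) (a k))
  = Cmod (a k) * Cmod z ^ k.
Proof.
  change (Cmod (Cmult (@pow_n C_AbsRing z k) (a k)) = Cmod (a k) * Cmod z ^ k).
  rewrite Cmod_mult, Cmod_pow_n; apply Rmult_comm.
Qed.

Lemma ex_pseries_bounded_terms (a : nat -> C) (z : C) :
  @ex_pseries C_AbsRing C_NormedModule a z ->
  exists M : R, 0 < M /\ forall k, Cmod (a k) * Cmod z ^ k <= M.
Proof.
  intros H.
  destruct (@Cauchy_ex_series C_AbsRing C_CompleteNormedModule _ H
              (mkposreal 1 Rlt_0_1)) as [n Hn].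
  apply (bounded_of_eventually_le (fun k => Cmod (a k) * Cmod z ^ k) 1).
  exists n; intros k Hk; rewrite <- norm_pseries_term.
  specialize (Hn k k Hk Hk); rewrite sum_n_n in Hn; left; exact Hn.
Qed.

(** Inside the real radius the complex series converges absolutely; outside it,
    convergence would bound the terms, and the real radius is the supremum of
    the radii at which the terms are bounded. *)
Lemma CV_radius_Cmod_is_radius (a : nat -> C) :
  is_radius_of_convergence a (CV_radius (fun k => Cmod (a k))).
Proof.
  split; intros z Hz.
  - apply (@ex_series_le C_AbsRing C_CompleteNormedModule _
             (fun k => Rabs (Cmod (a k) * Cmod z ^ k))).
    + intros k; apply Rle_trans with (2 := Rle_abs _).
      right; apply norm_pseries_term.
    + apply CV_disk_inside; rewrite Rabs_pos_eq by apply Cmod_ge_0; exact Hz.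
  - intros H; destruct (ex_pseries_bounded_terms a z H) as [M [_ HM]].
    apply (Rbar_lt_not_le _ _ Hz).
    apply (proj1 (CV_radius_bounded (fun k => Cmod (a k)))).
    exists M; intros k; rewrite Rabs_pos_eq; [apply HM|].
    apply Rmult_le_pos; [apply Cmod_ge_0 | apply pow_le, Cmod_ge_0].
Qed.

Lemma is_pseries_coef_0 (a : nat -> C) (z l : C) :
  (forall k, a k = RtoC 0) -> @is_pseries C_AbsRing C_NormedModule a z l ->
  l = RtoC 0.
Proof.
  intros Ha Hl.
  apply (@filterlim_locally_unique nat C_AbsRing C_NormedModule eventually _ _ _ _ Hl).
  apply filterlim_ext with (fun _ : nat => RtoC 0); [|apply filterlim_const].
  intros n; symmetry; unfold sum_n.
  transitivity (@sum_n_m C_NormedModule (fun _ => zero) 0 n).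
  - apply sum_n_m_ext; intros k; rewrite Ha.
    apply (@scal_zero_r C_AbsRing C_NormedModule).
  - exact (@sum_n_m_const_zero C_NormedModule 0 n).
Qed.

Lemma ex_first_nonzero (a : nat -> C) :
  (exists k, a k <> RtoC 0) -> exists N, first_nonzero a N.
Proof.
  intros [k Hk].
  destruct (dec_inh_nat_subset_has_unique_least_element (fun k => a k <> RtoC 0))
    as [N [[HN Hmin] _]].
  - intros n; apply classic.
  - exists k; exact Hk.
  - exists N; split; [exact HN|].
    intros j Hj; apply NNPP; intros Hne; specialize (Hmin j Hne); lia.
Qed.

(** * Domination up to the radius of convergence *)

(** Up to a constant, [s k] is the modulus of the [k]-th term on the circle of
    radius [r], which may be the boundary circle: there the terms need not be
    bounded, but boundedness on every smaller circle limits them to growth of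
    exponential rate [0]. *)
Lemma subexponential_boundary_terms (a : nat -> C) (r : R) (Rhat : Rbar) (n : nat)
    (c : R) (s : nat -> R) :
  is_radius_of_convergence a Rhat -> 0 < r -> Rbar_le r Rhat ->
  0 <= c -> (forall k, (n < k)%nat -> s k = r ^ k * Cmod (a k) * c) ->
  subexponential s.
Proof.
  intros [Hconv _] Hr HrR Hc Hs; apply subexponential_iff_le_pow; intros x Hx.
  (* [y ^ 2 = x]: one factor [y ^ k] pays for moving from [r] to [r / y], the
     other absorbs the bound on the terms at [r / y]. *)
  set (y := sqrt x).
  assert (Hyy : y * y = x) by (apply sqrt_sqrt; lra).
  assert (Hy : 1 < y) by (rewrite <- sqrt_1; apply sqrt_lt_1; lra).
  set (rho := r / y).
  assert (Hrho : 0 < rho) by (apply Rdiv_lt_0_compat; lra).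
  assert (Hrhor : rho * y = r) by (unfold rho; field; lra).
  assert (Hmod : Cmod (RtoC rho) = rho) by (rewrite Cmod_R; apply Rabs_pos_eq; lra).
  destruct (ex_pseries_bounded_terms a (RtoC rho)) as [M [_ HM]].
  { apply Hconv; rewrite Hmod; apply Rbar_lt_le_trans with (2 := HrR); simpl; nra. }
  rewrite Hmod in HM.
  destruct (eventually_le_pow (M * c) y Hy) as [m Hm].
  exists (m + S n)%nat; intros k Hk.
  rewrite Hs by lia; rewrite <- Hyy, <- Hrhor, !Rpow_mult_distr.
  assert (Hyk : 0 < y ^ k) by (apply pow_lt; lra).
  specialize (Hm k ltac:(lia)); specialize (HM k).
  apply Rle_trans with (M * c * y ^ k); [|apply Rmult_le_compat_r; lra].
  replace (rho ^ k * y ^ k * Cmod (a k) * c)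
    with (Cmod (a k) * rho ^ k * (c * y ^ k)) by ring.
  rewrite (Rmult_assoc M); apply Rmult_le_compat_r; [|exact HM].
  apply Rmult_le_pos; lra.
Qed.

Lemma Taylor_domination_first_nonzero (a : nat -> C) (N : nat) (Rhat : Rbar) (r : R)
    (s : nat -> R) :
  is_radius_of_convergence a Rhat -> a N <> RtoC 0 ->
  0 < r -> Rbar_le r Rhat ->
  (forall k : nat, (N < k)%nat ->
     s k = r ^ k * Cmod (a k) * / (Cmod (a N) * r ^ N)) ->
  Taylor_domination a N r s.
Proof.
  intros Hrad HN Hr HrR Hs.
  assert (HD : 0 < Cmod (a N) * r ^ N).
  { apply Rmult_lt_0_compat; [apply Cmod_gt_0, HN | apply pow_lt, Hr]. }
  assert (Hs0 : forall k, (N + 1 <= k)%nat -> 0 <= s k).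
  { intros k Hk; rewrite Hs by lia; apply Rmult_le_pos.
    - apply Rmult_le_pos; [apply pow_le; lra | apply Cmod_ge_0].
    - left; apply Rinv_0_lt_compat, HD. }
  split; [exact Hr|]; split; [exact Hs0|]; split.
  - apply (subexponential_boundary_terms a r Rhat N _ s Hrad Hr HrR) with (2 := Hs).
    left; apply Rinv_0_lt_compat, HD.
  - intros k Hk; apply Rle_trans with (s k * (Cmod (a N) * r ^ N)).
    + right; rewrite Hs by lia; field.
      split; [apply Rgt_not_eq, pow_lt, Hr | apply Rgt_not_eq, Cmod_gt_0, HN].
    + apply Rmult_le_compat_l; [apply Hs0, Hk|].
      apply (le_max_upto (fun i => Cmod (a i) * r ^ i)); lia.
Qed.

(** * Domination on smaller disks *)

(** Adding [1] makes the constant positive even when [s] vanishes beyond [N]. *)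
Definition damped_sup (N : nat) (s : nat -> R) (q : R) : R :=
  1 + real (Sup_seq (fun j => Finite (s (N + 1 + j)%nat * q ^ (1 + j)))).

Lemma damped_sup_spec (N : nat) (s : nat -> R) (q : R) :
  (forall k, (N + 1 <= k)%nat -> 0 <= s k) -> subexponential s -> 0 < q < 1 ->
  0 < damped_sup N s q /\
  forall k, (N + 1 <= k)%nat -> s k * q ^ (k - N) <= damped_sup N s q.
Proof.
  intros Hs0 Hs Hq.
  assert (HqN : 0 < q ^ N) by (apply pow_lt; lra).
  set (u := fun j => s (N + 1 + j)%nat * q ^ (1 + j)).
  assert (Hu0 : forall j, 0 <= u j).
  { intros j; apply Rmult_le_pos; [apply Hs0; lia | apply pow_le; lra]. }
  destruct (bounded_of_eventually_le u (/ q ^ N)) as [B [_ HB]].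
  { assert (Hx : 1 < / q) by (rewrite <- Rinv_1; apply Rinv_lt_contravar; lra).
    destruct (proj1 (subexponential_iff_le_pow s) Hs _ Hx) as [n Hn].
    exists n; intros j Hj; unfold u.
    apply Rle_trans with ((/ q) ^ (N + 1 + j) * q ^ (1 + j)).
    - apply Rmult_le_compat_r; [apply pow_le; lra | apply Hn; lia].
    - right; rewrite pow_inv.
      replace (N + 1 + j)%nat with (N + (1 + j))%nat by lia; rewrite pow_add.
      field; split; apply pow_nonzero; lra. }
  assert (Hsup : forall j, u j <= real (Sup_seq (fun j => Finite (u j)))).
  { generalize (Sup_seq_correct (fun j => Finite (u j))).
    destruct (Sup_seq _) as [l| |]; intros Hl j.
    - exact (is_sup_seq_major _ _ j Hl).
    - destruct (Hl B) as [i Hi]; simpl in Hi; specialize (HB i); lra.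
    - specialize (Hl 0 j); simpl in Hl; specialize (Hu0 j); lra. }
  unfold damped_sup; fold u; split.
  - specialize (Hsup O); specialize (Hu0 O); unfold u in Hsup, Hu0 |- *; lra.
  - intros k Hk; specialize (Hsup (k - N - 1)%nat); unfold u in Hsup at 1.
    replace (N + 1 + (k - N - 1))%nat with k in Hsup by lia.
    replace (1 + (k - N - 1))%nat with (k - N)%nat in Hsup by lia.
    unfold u in Hsup |- *; lra.
Qed.

(** Shrinking the radius gains a factor [q ^ k] on the left, while the maximum
    over the first [N + 1] terms loses at most [q ^ N]; the net gain
    [q ^ (k - N)] makes [s] bounded, with a bound depending on [r] and [r'] only
    through their ratio. *)
Lemma Taylor_domination_smaller_radius (a : nat -> C) (N : nat) (r r' : R)
    (s : nat -> R) :
  Taylor_domination a N r s -> 0 < r' -> r' < r ->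
  0 < damped_sup N s (r' / r) /\
  Taylor_domination a N r' (fun _ => damped_sup N s (r' / r)).
Proof.
  intros (Hr & Hs0 & Hs & Hdom) Hr' Hlt.
  set (q := r' / r).
  assert (Hqr : q * r = r') by (unfold q; field; lra).
  assert (Hq : 0 < q < 1).
  { split; [apply Rdiv_lt_0_compat; lra | apply Rmult_lt_reg_r with r; lra]. }
  destruct (damped_sup_spec N s q Hs0 Hs Hq) as [HC0 HC].
  split; [exact HC0|]; split; [exact Hr'|]; split; [intros; lra|].
  split; [apply subexponential_const|]; intros k Hk.
  set (m' := max_upto (fun i => Cmod (a i) * r' ^ i) N).
  set (m := max_upto (fun i => Cmod (a i) * r ^ i) N) in Hdom.
  assert (Hm'0 : 0 <= m').
  { apply Rle_trans with (Cmod (a O) * r' ^ 0).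
    - simpl; rewrite Rmult_1_r; apply Cmod_ge_0.
    - apply (le_max_upto (fun i => Cmod (a i) * r' ^ i)); lia. }
  assert (HqN : 0 < q ^ N) by (apply pow_lt; lra).
  assert (Hm : m * q ^ N <= m').
  { apply Rmult_le_reg_r with (/ q ^ N); [apply Rinv_0_lt_compat, HqN|].
    rewrite Rmult_assoc, Rinv_r, Rmult_1_r by lra.
    apply max_upto_le; intros i Hi.
    apply Rmult_le_reg_r with (q ^ N); [exact HqN|].
    rewrite (Rmult_assoc m'), Rinv_l, Rmult_1_r by lra.
    apply Rle_trans with (Cmod (a i) * r' ^ i).
    - rewrite <- Hqr, Rpow_mult_distr.
      assert (Hqi : q ^ N <= q ^ i).
      { replace N with (i + (N - i))%nat by lia; rewrite pow_add.
        assert (0 < q ^ i) by (apply pow_lt; lra).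
        generalize (pow_incr q 1 (N - i) ltac:(lra)); rewrite pow1; nra. }
      assert (Hai : 0 <= Cmod (a i) * r ^ i).
      { apply Rmult_le_pos; [apply Cmod_ge_0 | apply pow_le; lra]. }
      nra.
    - apply (le_max_upto (fun i => Cmod (a i) * r' ^ i)), Hi. }
  assert (Hqk : q ^ k = q ^ (k - N) * q ^ N).
  { rewrite <- pow_add; f_equal; lia. }
  assert (Hqk0 : 0 < q ^ (k - N)) by (apply pow_lt; lra).
  apply Rle_trans with (s k * q ^ (k - N) * m').
  - apply Rle_trans with (s k * q ^ (k - N) * (m * q ^ N)).
    + rewrite <- Hqr, Rpow_mult_distr, Hqk.
      replace (s k * q ^ (k - N) * (m * q ^ N))
        with (s k * m * (q ^ (k - N) * q ^ N)) by ring.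
      replace (Cmod (a k) * (q ^ (k - N) * q ^ N * r ^ k))
        with (Cmod (a k) * r ^ k * (q ^ (k - N) * q ^ N)) by ring.
      apply Rmult_le_compat_r; [apply Rmult_le_pos; lra | apply Hdom, Hk].
    + apply Rmult_le_compat_l; [|exact Hm].
      apply Rmult_le_pos; [apply Hs0, Hk | lra].
  - apply Rmult_le_compat_r; [exact Hm'0 | apply HC, Hk].
Qed.

(** Domination by a constant at [r' < r] bounds the terms at [r'], so every such
    [r'] is at most the radius of convergence. *)
Lemma Taylor_domination_le_CV_radius (a : nat -> C) (N : nat) (r : R) (s : nat -> R) :
  Taylor_domination a N r s -> Rbar_le r (CV_radius (fun k => Cmod (a k))).
Proof.
  intros H; pose proof (proj1 H) as Hr.
  apply Rbar_not_lt_le; intros Hlt.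
  assert (Hle : forall r', 0 < r' -> r' < r ->
            Rbar_le r' (CV_radius (fun k => Cmod (a k)))).
  { intros r' Hr' Hr'r.
    destruct (Taylor_domination_smaller_radius a N r r' s H Hr' Hr'r)
      as (_ & _ & _ & _ & Hdom).
    destruct (bounded_of_eventually_le (fun k => Cmod (a k) * r' ^ k) _
                (ex_intro _ (N + 1)%nat Hdom)) as [B [_ HB]].
    apply (proj1 (CV_radius_bounded (fun k => Cmod (a k)))).
    exists B; intros k; rewrite Rabs_pos_eq; [apply HB|].
    apply Rmult_le_pos; [apply Cmod_ge_0 | apply pow_le; lra]. }
  generalize (CV_radius_ge_0 (fun k => Cmod (a k))).
  destruct (CV_radius _) as [l| |]; simpl in *; [|contradiction|tauto].
  intros Hl; generalize (Hle ((l + r) / 2)); lra.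
Qed.

Theorem proposition1p1 :
  (forall (f : C -> C) (a : nat -> C) (Rhat : Rbar),
     Rbar_lt 0 Rhat ->
     has_Taylor_series f a Rhat ->
     (exists z : C, Rbar_lt (Cmod z) Rhat /\ f z <> RtoC 0) ->
     exists N : nat,
       first_nonzero a N /\
       forall r : R, 0 < r -> Rbar_le r Rhat ->
       forall s : nat -> R,
         (forall k : nat, (N < k)%nat ->
            s k = r ^ k * Cmod (a k) * / (Cmod (a N) * r ^ N)) ->
         Taylor_domination a N r s)
  /\
  (forall (N : nat) (s : nat -> R),
     exists C0 : R -> R,
       forall (a : nat -> C) (r : R),
         Taylor_domination a N r s ->
         (exists Rstar : Rbar,
            is_radius_of_convergence a Rstar /\ Rbar_le r Rstar) /\
         (forall r' : R, 0 < r' -> r' < r ->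
            0 < C0 (r' / r) /\
            Taylor_domination a N r' (fun _ : nat => C0 (r' / r)))).
Proof.
  split.
  - intros f a Rhat _ [Hrad Hf] [z [Hz Hfz]].
    destruct (ex_first_nonzero a) as [N HN].
    { apply NNPP; intros Hall; apply Hfz.
      apply (is_pseries_coef_0 a z _) with (2 := Hf z Hz).
      intros k; apply NNPP; intros Hk; apply Hall; exists k; exact Hk. }
    exists N; split; [exact HN|].
    intros r Hr HrR s Hs.
    exact (Taylor_domination_first_nonzero a N Rhat r s Hrad (proj1 HN) Hr HrR Hs).
  - intros N s; exists (damped_sup N s); intros a r H; split.
    + exists (CV_radius (fun k => Cmod (a k))); split.
      * apply CV_radius_Cmod_is_radius.
      * exact (Taylor_domination_le_CV_radius a N r s H).
    + intros r' Hr' Hlt.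
      exact (Taylor_domination_smaller_radius a N r r' s H Hr' Hlt).
Qed.
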